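(* Let $g:\mathbb{N}\to\mathbb{N}$ be a function such that for every $k\in\mathbb{N}$, every digraph $D$ with $\delta^+(D)\geq g(k)$ contains $k$ vertex-disjoint directed cycles of pairwise distinct lengths. Then for all $k,m\in\mathbb{N}$, every digraph $D$ with $\delta^+(D)\geq g(k)\cdot m$, and every edge-weighting $w:E(D)\to S$ for some set $S\subseteq\mathbb{R}_+$ with $|S|=m$, there exist $k$ vertex-disjoint directed cycles in $D$ with pairwise distinct total weights according to $w$.
   Context: $\mathbb{N}=\{1,2,3,\ldots\}$ and $\mathbb{R}_+$ is the set of strictly positive real numbers. All digraphs are finite, non-empty and simple (no loops, no parallel edges in the same direction), but anti-parallel pairs of edges are allowed. $\delta^+(D)=\min_{v\in V(D)} d_D^+(v)$ denotes the minimum out-degree. The length of a directed cycle is its number of edges; directed cycles of length $2$ are allowed. The total weight of a directed cycle $C$ according to $w$ is $\sum_{e\in E(C)}w(e)$. A function $g$ with the property assumed in the claim exists (this is a theorem, known as Lichiardopol's conjecture). *)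

(* Defs.v *)
From mathcomp Require Import all_boot all_order all_algebra.
From mathcomp Require Import finmap reals.

Set Implicit Arguments.
Unset Strict Implicit.
Unset Printing Implicit Defensive.

Local Open Scope ring_scope.

(* [edge] is a boolean relation, so there are no parallel edges, while
   [edge x y] and [edge y x] may hold together. *)
Record digraph := Digraph {
  vertex :> finType;
  edge : rel vertex;
  edge_irr : irreflexive edge;
  vertex_gt0 : (0 < #|vertex|)%N
}.

Definition outdeg (D : digraph) (x : D) : nat := #|[set y | edge x y]|.

(* Out-degrees are at most #|D| and D is non-empty, so the default value #|D|
   does not affect the minimum. *)
Definition min_outdeg (D : digraph) : nat :=
  \big[minn/#|D|]_(x : D) outdeg x.

Lemma leq_min_outdeg (D : digraph) (n : nat) :
  (n <= min_outdeg D)%N <-> forall x : D, (n <= outdeg x)%N.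
Proof.
split=> [le_n x | le_n].
  apply: leq_trans le_n _; rewrite /min_outdeg.
  elim: (index_enum _) (mem_index_enum x) => // y s IHs.
  rewrite inE big_cons geq_min => /predU1P[->|/IHs ->]; last exact: orbT.
  by rewrite leqnn.
rewrite /min_outdeg; elim/big_ind: _ => [|a b le_a le_b|x _].
- case/card_gt0P: (vertex_gt0 D) => x _.
  exact: leq_trans (le_n x) (max_card _).
- by rewrite leq_min le_a.
- exact: le_n.
Qed.

(* A directed cycle is given by the list of its vertices in cyclic order, from
   an arbitrary starting point; the edge from the last to the first vertex is
   part of [cycle]. Its length is the size of the list, which is at least 2 as
   there are no loops. *)
Definition dicycle (D : digraph) (c : seq D) : bool :=
  [&& c != [::], uniq c & cycle (@edge D) c].

(* The values of w outside the edges of D are irrelevant on directed cycles. *)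
Definition weight (R : realType) (D : digraph) (w : D -> D -> R) (c : seq D) :
    R :=
  \sum_(x <- c) w x (next c x).

(* f is meant to be the length [size] or the total weight [weight w]; the last
   clause says that its values on the k cycles are pairwise distinct. *)
Definition disjoint_dicycles (A : Type) (D : digraph) (k : nat)
    (f : seq D -> A) : Prop :=
  exists C : 'I_k -> seq D,
    [/\ forall i, dicycle (C i),
        forall i j, i != j -> [disjoint C i & C j]
      & injective (fun i => f (C i))].

(* Main.v *)
(* Every vertex v keeps only the out-edges of one weight x(v), chosen by
   pigeonhole so that at least g(k) of them remain. The system of all equalities
   between subset sums of x is rational and has the positive real solution x,
   hence a positive integer solution z. Replace v by a single entry vertex
   followed by z(v) - 1 layers of more than g(k) vertices, consecutive layers
   being completely joined, with the last layer joined to the entries of the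
   out-neighbours of v. Out-degrees stay at least g(k), and as each v has a single
   entry, disjoint cycles of the new digraph project to disjoint cycles of D, the
   length of the former being the z-weight of the latter. Distinct lengths give
   distinct z-weights, and so distinct weights by the choice of z. *)
Require Import Defs.
From mathcomp Require Import all_boot all_order all_algebra.
From mathcomp Require Import finmap reals.

Set Implicit Arguments.
Unset Strict Implicit.
Unset Printing Implicit Defensive.

Import Order.TTheory GRing.Theory Num.Theory.

Local Open Scope ring_scope.

Lemma pigeonhole_fiber (T : finType) (V : eqType) (f : T -> V) (n : nat)
    (r : seq V) (A : {set T}) :
  (0 < size r)%N -> {in A, forall u, f u \in r} -> (n * size r <= #|A|)%N ->
  exists s, (n <= #|[set u in A | f u == s]|)%N.
Proof.
elim: r A => // s r IHr A _ fA le_n.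
case: (leqP n #|[set u in A | f u == s]|) => [|lt_n]; first by exists s.
(* With a single value left its fiber is all of [A]; otherwise the rest of [A] still has at least
   [n * size r] elements. *)
case: r => [|s' r] in IHr fA le_n *.
  have eA : [set u in A | f u == s] = A.
    apply/setP=> u; rewrite inE andb_idr // => /fA.
    by rewrite inE.
  by move: lt_n; rewrite eA ltnNge (leq_trans _ le_n) ?muln1.
have [||t le_t] := IHr (A :\: [set u in A | f u == s]) isT.
- move=> u; rewrite !inE => /andP[+ uA].
  by rewrite uA /= => /negPf fus; move: (fA u uA); rewrite inE fus.
- have := cardsID [set u in A | f u == s] A.
  have /setIidPr-> : [set u in A | f u == s] \subset A.
    by apply/subsetP=> u; rewrite inE => /andP[].
  move=> eqA; rewrite -(leq_add2l #|[set u in A | f u == s]|) eqA.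
  by apply: leq_trans le_n; rewrite [leqRHS]mulnS leq_add2r ltnW.
exists t; apply: leq_trans le_t _; apply/subset_leq_card/subsetP=> u.
by rewrite !inE => /andP[/andP[_ ->]].
Qed.

(** Kernels commute with field extension, so [x] is a real combination of rational kernel vectors.
    Rational coefficients close enough to the real ones keep every coordinate positive, and clearing
    denominators gives integers. *)
Lemma pos_nat_kernel (R : realType) (m n : nat) (A : 'M[rat]_(m, n))
    (x : 'rV[R]_m) :
  (forall i, 0 < x 0 i) -> x *m map_mx ratr A = 0 ->
  exists2 z : 'I_m -> nat, forall i, (0 < z i)%N &
    (\row_i (z i)%:R : 'rV[rat]_m) *m A = 0.
Proof.
move=> x_gt0 /sub_kermxP; rewrite -map_kermx => /submxP[y xE].
set K := kermx A in xE.
(* Moving each coefficient by less than [eps] moves coordinate [i] by less than [x 0 i]. *)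
have [eps eps_gt0 eps_lt] : exists2 eps : R, 0 < eps & forall i,
    eps * \sum_j `|ratr (K j i)| < x 0 i.
  pose e i : R := x 0 i / (1 + \sum_j `|ratr (K j i)|).
  have S_ge0 i : 0 <= \sum_j `|ratr (K j i) : R| by apply: sumr_ge0.
  have S_gt0 i : 0 < 1 + \sum_j `|ratr (K j i) : R| by rewrite ltr_pwDl.
  have e_gt0 i : 0 < e i by rewrite divr_gt0.
  exists (\big[Num.min/1]_i e i).
    by elim/big_ind: _ => // a b a0 b0; rewrite lt_min a0.
  move=> i; apply: (@le_lt_trans _ _ (e i * \sum_j `|ratr (K j i)|)).
    by rewrite ler_wpM2r // bigmin_le_cond.
  by rewrite /e mulrAC ltr_pdivrMr // ltr_pM2l // ltrDr.
have /fin_all_exists[q qP] : forall j, exists q : rat, `|y 0 j - ratr q| < eps.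
  move=> j; have [] := @rat_in_itvoo R (y 0 j - eps) (y 0 j + eps).
    by rewrite ltrD2l gt0_cp.
  move=> q; rewrite in_itv /= => qI; exists q.
  by rewrite distrC ltr_distl.
pose v : 'rV[rat]_m := (\row_j q j) *m K.
have v_gt0 i : 0 < v 0 i.
  rewrite -(ltr0q R).
  have d_lt : `|x 0 i - ratr (v 0 i)| < x 0 i.
    apply: le_lt_trans (eps_lt i).
    rewrite xE !mxE rmorph_sum /= -sumrB mulr_sumr.
    apply: le_trans (ler_norm_sum _ _ _) (ler_sum _ _) => j _.
    by rewrite !mxE rmorphM -mulrBl normrM ler_wpM2r // ltW.
  by move: d_lt; rewrite distrC ltr_distl subrr => /andP[].
pose d : nat := (\prod_i `|denq (v 0%R i)|)%N.
have natv i : exists z : nat, d%:R * v 0 i = z%:R.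
  exists ((\prod_(j | j != i) `|denq (v 0%R j)|) * `|numq (v 0%R i)|)%N.
  rewrite /d (bigD1 i) //= mulnC natrM -mulrA natrM; congr (_ * _).
  rewrite !natr_absz !ger0_norm ?denq_ge0 ?numq_ge0 ?ltW //.
  by rewrite mulrC -numqE.
have /fin_all_exists[z zE] := natv.
exists z.
  move=> i; rewrite -(ltr0n rat) -zE mulr_gt0 // ltr0n.
  by apply: prodn_gt0 => j; rewrite absz_gt0 denq_neq0.
have -> : \row_i (z i)%:R = d%:R *: v.
  by apply/rowP=> i; rewrite !mxE -zE !mxE.
by rewrite -scalemxAl -mulmxA mulmx_ker mulmx0 scaler0.
Qed.

(** The matrix has one column per pair of subsets: the difference of their indicators if their
    [x]-sums agree, and zero, hence no constraint, otherwise. *)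
Lemma pos_nat_subset_sums (R : realType) (V : finType) (x : V -> R) :
  (forall v, 0 < x v) ->
  exists2 z : V -> nat, forall v, (0 < z v)%N & forall A B : {set V},
    \sum_(v in A) x v = \sum_(v in B) x v ->
    (\sum_(v in A) z v = \sum_(v in B) z v)%N.
Proof.
move=> x_gt0; pose T : finType := ({set V} * {set V})%type.
pose tied (t : T) := \sum_(v in t.1) x v == \sum_(v in t.2) x v.
pose coef (v : V) (t : T) : rat :=
  if tied t then (v \in t.1)%:R - (v \in t.2)%:R else 0.
(* The field is arbitrary because this serves both for [x] over [R] and for [z] over [rat]. *)
have coefE (F : numFieldType) (y : V -> F) t : tied t ->
    \sum_(i < #|V|) y (enum_val i) * ratr (coef (enum_val i) t) =
    \sum_(v in t.1) y v - \sum_(v in t.2) y v.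
  move=> tt; transitivity (\sum_v y v * ratr (coef v t)).
    by rewrite [RHS](reindex _ (onW_bij _ (@enum_val_bij V))).
  rewrite [in RHS]big_mkcond /= [X in _ - X]big_mkcond /= -sumrB.
  apply: eq_bigr => v _; rewrite /coef tt rmorphB /= !ratr_nat.
  by rewrite mulrBr !mulr_natr !mulrb.
pose A : 'M[rat]_(#|V|, #|T|) := \matrix_(i, j) coef (enum_val i) (enum_val j).
have [i||z z_gt0 zA] := @pos_nat_kernel R _ _ A (\row_i x (enum_val i)).
- by rewrite mxE.
- apply/rowP=> j; rewrite !mxE.
  under eq_bigr do rewrite !mxE.
  case tt : (tied (enum_val j)); first by rewrite coefE // (eqP tt) subrr.
  by rewrite big1 // => i _; rewrite /coef tt rmorph0 mulr0.
exists (fun v => z (enum_rank v)) => // B C eqBC.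
have tt : tied (B, C) by apply/eqP.
apply/eqP; rewrite -(eqr_nat rat) !natr_sum -subr_eq0.
rewrite -(coefE _ (fun v => (z (enum_rank v))%:R) (B, C) tt).
have /rowP/(_ (enum_rank (B, C))) := zA; rewrite !mxE => {2}<-.
by apply/eqP/eq_bigr => i _; rewrite !mxE !enum_rankK enum_valK /ratr divq_num_den.
Qed.

Section Layers.

Variables (V : finType) (e : rel V) (z : V -> nat) (n : nat).
Hypothesis e_irr : irreflexive e.
Hypothesis z_gt0 : forall v, (0 < z v)%N.

(* The vertex (v, i, j) lies in layer i of v. Those with i >= z v, and those with
   i = 0 and j != 0, are spurious: they have no in-edges, so no cycle meets them.
   The entry of v is (v, 0, 0). *)
Definition lvertex : finType :=
  (V * 'I_(\max_v z v).+1 * 'I_n.+1)%type.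

(** The second branch also takes the spurious vertices in layers beyond the last, so that their
    out-degree is large too. *)
Definition ledge : rel lvertex := fun a b =>
  if (a.1.2.+1 < z a.1.1)%N then (b.1.1 == a.1.1) && (b.1.2 == a.1.2.+1 :> nat)
  else [&& e a.1.1 b.1.1, b.1.2 == ord0 & b.2 == ord0].

Lemma ledge_irr : irreflexive ledge.
Proof.
move=> a; rewrite /ledge; case: ifP => _; last by rewrite e_irr.
by rewrite [_ == _.+1]ltn_eqF // andbF.
Qed.

Lemma ledge_outdeg (a : lvertex) : (forall v, n <= #|[set u | e v u]|)%N ->
  (n <= #|[set b | ledge a b]|)%N.
Proof.
move=> le_n; case lt_a: (a.1.2.+1 < z a.1.1)%N.
  have lt_M : (a.1.2.+1 < (\max_v z v).+1)%N.
    by rewrite ltnS ltnW // (leq_trans lt_a) // leq_bigmax.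
  pose h (j : 'I_n.+1) : lvertex := (a.1.1, Ordinal lt_M, j).
  have h_inj : injective h by move=> j j' [].
  apply: (@leq_trans #|[set h j | j : 'I_n.+1]|).
    by rewrite card_imset // card_ord.
  apply/subset_leq_card/subsetP=> _ /imsetP[j _ ->].
  by rewrite inE /ledge lt_a /= !eqxx.
pose h (u : V) : lvertex := (u, ord0, ord0).
have h_inj : injective h by move=> u u' [].
apply: leq_trans (le_n a.1.1) _; rewrite -(card_imset _ h_inj).
apply/subset_leq_card/subsetP=> _ /imsetP[u + ->].
by rewrite !inE /ledge lt_a => -> /=.
Qed.

Lemma ledge_layer0 a b : ledge a b -> b.1.2 = ord0 ->
  [/\ (z a.1.1 <= a.1.2.+1)%N, e a.1.1 b.1.1 & b.2 = ord0].
Proof.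
rewrite /ledge; case: ltnP => [_ /andP[_ /eqP bE] b0|le_z].
  by rewrite b0 in bE.
by case/and3P=> -> _ /eqP.
Qed.

Definition entries (c : seq lvertex) : seq V :=
  [seq a.1.1 | a <- c & a.1.2 == ord0].

(** A path climbs one layer at a time and leaves [v] only from its last layer. The term [a.1.2.+1]
    counts the layers of the first vertex up to [a]; the condition on [last a p] makes the final
    block complete. *)
Lemma ledge_path (a : lvertex) (p : seq lvertex) :
  (a.1.2 < z a.1.1)%N -> path ledge a p ->
  (z (last a p).1.1 <= (last a p).1.2.+1)%N ->
  [/\ path e a.1.1 (entries p), last a.1.1 (entries p) = (last a p).1.1 &
      (size p + a.1.2.+1 = z a.1.1 + \sum_(v <- entries p) z v)%N].
Proof.
elim: p a => [|b p IHp] a lt_a /=.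
  move=> _ le_z; rewrite big_nil addn0 add0n; split=> //.
  by apply/eqP; rewrite eqn_leq lt_a.
case/andP=> ab bp lastP.
have [b0|b_neq0] := eqVneq b.1.2 ord0.
  have [le_z eab _] := ledge_layer0 ab b0.
  have [|ep lastE sz] := IHp b _ bp lastP; first by rewrite b0.
  rewrite /entries /= b0 eqxx /= eab; split=> //.
  rewrite big_cons -[X in (_ = _ + X)%N]sz b0.
  have -> : z a.1.1 = a.1.2.+1 by apply/eqP; rewrite eqn_leq le_z.
  by rewrite addn1 addnC.
move: ab; rewrite /ledge.
case: ltnP => [lt_z /andP[/eqP bv /eqP bl]|_]; last first.
  by rewrite (negPf b_neq0) andbF.
have [|ep lastE sz] := IHp b _ bp lastP; first by rewrite bv bl.
rewrite bv bl in ep lastE sz.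
by rewrite /entries /= (negPf b_neq0); split=> //; rewrite -sz addSnnS.
Qed.

(** Without an entry, the layer index would increase strictly all around the cycle. *)
Lemma ledge_cycle_entry (c : seq lvertex) : c != [::] -> cycle ledge c ->
  exists2 a, a \in c & a.1.2 == ord0.
Proof.
move=> c_neq0 cyc; apply/hasP/negPn/negP; rewrite -all_predC => no_entry.
pose lt := relpre (fun a : lvertex => a.1.2 : nat) ltn.
have : cycle lt c.
  apply: sub_in_cycle no_entry cyc => a b _ /= b_neq0.
  rewrite unfold_in in b_neq0.
  rewrite /ledge /lt /=; case: ifP => [_ /andP[_ /eqP->] //|_].
  by rewrite (negPf b_neq0) andbF.
case: c c_neq0 {cyc no_entry} => //= a p _.
have lt_trans : transitive lt by move=> b a' d; apply: ltn_trans.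
move/(order_path_min lt_trans)/allP/(_ a).
by rewrite mem_rcons mem_head /lt /= ltnn => /(_ isT).
Qed.

Lemma ledge_dicycle (c : seq lvertex) :
  c != [::] -> uniq c -> cycle ledge c ->
  exists c' : seq V, [/\ c' != [::], uniq c', cycle e c',
    {in c', forall v, (v, ord0, ord0) \in c} & size c = (\sum_(v <- c') z v)%N].
Proof.
move=> c_neq0 uc cyc.
have [a ac a0] := ledge_cycle_entry c_neq0 cyc.
(* The edge from the predecessor on the cycle rules out the spurious vertices of layer 0. *)
have entryP b : b \in c -> b.1.2 == ord0 -> b = (b.1.1, ord0, ord0).
  move=> bc /eqP b0; have [_ _] := ledge_layer0 (prev_cycle cyc bc) b0.
  by case: b b0 {bc} => [[v i] j] /= -> ->.
have [i p rotE] := rot_to ac.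
have cycap : cycle ledge (a :: p) by rewrite -rotE rot_cycle.
have ent_a : entries (a :: p) = a.1.1 :: entries p by rewrite /entries /= a0.
exists (entries (a :: p)); rewrite -(size_rot i c) rotE.
move: cycap => /=; rewrite rcons_path => /andP[ap la].
have [le_z elast _] := ledge_layer0 la (eqP a0).
have [|ep lastE sz] := ledge_path _ ap le_z; first by rewrite (eqP a0) z_gt0.
split.
- by rewrite ent_a.
- rewrite map_inj_in_uniq ?filter_uniq -?rotE ?rot_uniq // => b d.
  rewrite !mem_filter !mem_rot => /andP[b0 bc] /andP[d0 dc] bd.
  by rewrite (entryP b) // (entryP d) // bd.
- by rewrite ent_a /= rcons_path ep lastE.
- move=> v /mapP[b]; rewrite mem_filter -rotE mem_rot => /andP[b0 bc] ->.
  by rewrite -entryP.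
- by rewrite ent_a big_cons -[RHS]sz (eqP a0) addn1.
Qed.

End Layers.

Theorem corollary4 (R : realType) (g : nat -> nat)
    (g_gt0 : forall k : nat, (0 < k)%N -> (0 < g k)%N)
    (g_cycles : forall k : nat, (0 < k)%N ->
      forall D : digraph, (g k <= min_outdeg D)%N ->
        disjoint_dicycles k (fun c : seq D => size c)) :
  forall k m : nat, (0 < k)%N -> (0 < m)%N ->
  forall D : digraph, (g k * m <= min_outdeg D)%N ->
  forall S : {fset R}, (forall s : R, s \in S -> 0 < s) -> #|` S|%fset = m ->
  forall w : D -> D -> R, (forall x y : D, edge x y -> w x y \in S) ->
    disjoint_dicycles k (weight w).
Proof.
move=> k m k_gt0 m_gt0 D /leq_min_outdeg degD S S_gt0 cardS w wS.
have /fin_all_exists[x0 x0P] (v : D) : exists s,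
    (g k <= #|[set u in [set u | edge v u] | w v u == s]|)%N.
  apply: (@pigeonhole_fiber _ _ _ _ (enum_fset S)).
  - by rewrite [size _]cardS.
  - by move=> u; rewrite inE => /wS.
  - by rewrite [size _]cardS; apply: degD.
pose e : rel D := fun v u => edge v u && (w v u == x0 v).
have e_irr : irreflexive e by move=> v; rewrite /e edge_irr.
have e_deg v : (g k <= #|[set u | e v u]|)%N.
  apply: leq_trans (x0P v) _; apply/subset_leq_card/subsetP=> u.
  by rewrite !inE.
(* Since [g k] is positive, some edge out of [v] has weight [x0 v], which therefore lies in [S]. *)
have x0_gt0 v : 0 < x0 v.
  have /card_gt0P[u] := leq_trans (g_gt0 k k_gt0) (e_deg v).
  by rewrite inE => /andP[vu /eqP <-]; apply/S_gt0/wS.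
have [z z_gt0 zP] := pos_nat_subset_sums x0_gt0.
have lvertex_gt0 : (0 < #|lvertex z (g k)|)%N.
  have /card_gt0P[v _] := vertex_gt0 D.
  by apply/card_gt0P; exists (v, ord0, ord0).
pose D' := Digraph (ledge_irr (n := g k) e_irr) lvertex_gt0.
have [|C [Ccyc Cdisj Cinj]] := g_cycles k k_gt0 D'.
  by apply/leq_min_outdeg => a; apply: ledge_outdeg.
have /fin_all_exists[C' C'P] i : exists c' : seq D,
    [/\ c' != [::], uniq c', cycle e c',
      {in c', forall v, (v, ord0, ord0) \in C i} &
      size (C i) = (\sum_(v <- c') z v)%N].
  by have /and3P[Ci_neq0 uCi cCi] := Ccyc i; apply: ledge_dicycle.
exists C'; split.
- move=> i; have [C'i_neq0 uC'i cC'i _ _] := C'P i.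
  rewrite /dicycle C'i_neq0 uC'i; apply: sub_cycle cC'i.
  by move=> v u /andP[].
- move=> i j ij; have [_ _ _ Ci _] := C'P i; have [_ _ _ Cj _] := C'P j.
  apply/pred0P=> v /=; apply/negP=> /andP[/Ci vi /Cj vj].
  by have /pred0P/(_ (v, ord0, ord0)) := Cdisj i j ij; rewrite /= vi vj.
(* Each edge of the cycle weighs [x0] of its tail, so the weight is a subset sum, as [zP]
   requires. *)
have weightE i : weight w (C' i) = \sum_(v in [set v in C' i]) x0 v.
  have [_ uC'i cC'i _ _] := C'P i.
  rewrite (eq_bigl (mem (C' i))) => [|v]; last by rewrite inE.
  rewrite -big_uniq // /weight; apply: eq_big_seq => v vC.
  by have /andP[_ /eqP] := next_cycle cC'i vC.
have sizeE i : size (C i) = (\sum_(v in [set v in C' i]) z v)%N.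
  have [_ uC'i _ _ ->] := C'P i; rewrite big_uniq //.
  by apply: eq_bigl => v; rewrite inE.
move=> i j /=; rewrite !weightE => /zP; rewrite -!sizeE.
exact: Cinj.
Qed.
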